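(* Let $A\in L^\infty_\#(\mathcal Y;\mathbb R^{d\times d})$ and let $\boldsymbol N\in\mathbb N^d$ have all components odd. Let $\widehat{\mathsf A}^{\mathrm{full}}_{\boldsymbol N},\mathsf A^{\mathrm{full}}_{\boldsymbol N}$ be the matrices with $$\bigl(\widehat{\mathsf A}^{\mathrm{full}}_{\boldsymbol N}\bigr)^{lk}=\int_{\mathcal Y}A(x)\varphi_k(x)\varphi_{-l}(x)\,dx\quad(l,k\in\mathbb Z^d_{\boldsymbol N}),\qquad \mathsf A^{\mathrm{full}}_{\boldsymbol N}=\mathsf F_{\boldsymbol N}^{-1}\widehat{\mathsf A}^{\mathrm{full}}_{\boldsymbol N}\mathsf F_{\boldsymbol N},$$ and let $\mathsf A_{2\boldsymbol N}$ be the block-diagonal matrix with $(\mathsf A_{2\boldsymbol N})^{kl}_{\alpha\beta}=\delta_{kl}\sum_{n\in\mathbb Z^d_{2\boldsymbol N-\boldsymbol 1}}\omega_{2\boldsymbol N}^{kn}\hat A_{\alpha\beta}(n)$ for $k,l\in\mathbb Z^d_{2\boldsymbol N}$. Then, with $\mathbb S^d=\{0,1\}^d$, $$\mathsf A^{\mathrm{full}}_{\boldsymbol N}=2^{-d}\sum_{s\in\mathbb S^d}\mathsf F_{\boldsymbol N}^{-1}\mathsf S^*_{\boldsymbol N}(s)\,\mathsf F_{\boldsymbol N}\,\mathsf A_{\boldsymbol N}(s)\,\mathsf F_{\boldsymbol N}^{-1}\mathsf S_{\boldsymbol N}(s)\,\mathsf F_{\boldsymbol N},$$ $$\widehat{\mathsf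 A}^{\mathrm{full}}_{\boldsymbol N}=2^{-d}\sum_{s\in\mathbb S^d}\mathsf S^*_{\boldsymbol N}(s)\,\mathsf F_{\boldsymbol N}\,\mathsf A_{\boldsymbol N}(s)\,\mathsf F_{\boldsymbol N}^{-1}\mathsf S_{\boldsymbol N}(s),$$ where for $s\in\mathbb S^d$ the matrices $\mathsf S_{\boldsymbol N}(s),\mathsf A_{\boldsymbol N}(s)\in[\mathbb C^{d\times\boldsymbol N}]^2$ are $$\mathsf S_{\boldsymbol N}(s)=\bigl(\delta_{\alpha\beta}\delta_{mn}\,\omega_{2\boldsymbol N}^{-sm}\bigr)^{m,n\in\mathbb Z^d_{\boldsymbol N}}_{\alpha,\beta},\qquad \mathsf A_{\boldsymbol N}(s)=\bigl(\delta_{kr}\,(\mathsf A_{2\boldsymbol N})^{(2r-s)(2r-s)}_{\alpha\beta}\bigr)^{k,r\in\mathbb Z^d_{\boldsymbol N}}_{\alpha,\beta}.$$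
   Context: Let $d\in\{2,3\}$, $\mathcal Y=(-\tfrac12,\tfrac12)^d$; $L^\infty_\#(\mathcal Y;X)$ is the space of essentially bounded $\mathcal Y$-periodic (period lattice $\mathbb Z^d$) $X$-valued functions. $\varphi_k(x)=\exp(2\pi i\,k\cdot x)$ and $\hat f(k)=\int_{\mathcal Y}f(x)\varphi_{-k}(x)\,dx$ for $k\in\mathbb Z^d$ (entrywise for matrix-valued $f$). For $\boldsymbol M\in\mathbb N^d$: $\mathbb Z^d_{\boldsymbol M}=\{k\in\mathbb Z^d:-M_\alpha/2\le k_\alpha<M_\alpha/2\}$; $|\boldsymbol M|=\prod_\alpha M_\alpha$; $\omega_{\boldsymbol M}^{kn}=\exp(2\pi i\sum_\alpha k_\alpha n_\alpha/M_\alpha)$ for $k,n\in\mathbb Z^d$ (and $\omega_{\boldsymbol M}^{-kn}=\omega_{\boldsymbol M}^{(-k)n}$). $2\boldsymbol N-\boldsymbol 1=(2N_\alpha-1)_\alpha$. $\mathbb C^{d\times\boldsymbol N}$ is the space of families $\mathsf u=(\mathsf u^k_\alpha)$, $\alpha=1,\dots,d$, $k\in\mathbb Z^d_{\boldsymbol N}$; $[\mathbb C^{d\times\boldsymbol N}]^2$ is the space of matrices $\mathsf U=(\mathsf U^{kl}_{\alpha\beta})$ with blocks $\mathsf U^{kl}\in\mathbb C^{d\times d}$, acting and multiplying as ordinary matrices over the joint index $(\alpha,k)$; $\mathsf U^*$ is the conjugate transpose. DFT matrices: $\mathsf F_{\boldsymbol N}=\frac1{|\boldsymbol N|}(\delta_{\alpha\beta}\omega_{\boldsymbol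 N}^{-mk})^{m,k\in\mathbb Z^d_{\boldsymbol N}}_{\alpha,\beta}$ and $\mathsf F_{\boldsymbol N}^{-1}=(\delta_{\alpha\beta}\omega_{\boldsymbol N}^{mk})^{m,k\in\mathbb Z^d_{\boldsymbol N}}_{\alpha,\beta}$. For $r\in\mathbb Z^d_{\boldsymbol N}$ with $\boldsymbol N$ odd and $s\in\{0,1\}^d$, one has $2r-s\in\mathbb Z^d_{2\boldsymbol N}$. *)

(* Defs.v *)
From HB Require Import structures.
From mathcomp Require Import all_boot all_order all_algebra spectral zify.
From mathcomp Require Import complex.
From mathcomp Require Import all_classical all_reals all_analysis.

Set Implicit Arguments.
Unset Strict Implicit.
Unset Printing Implicit Defensive.

Import Order.TTheory GRing.Theory Num.Theory.
Import numFieldNormedType.Exports.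

Local Open Scope classical_set_scope.
Local Open Scope ring_scope.
Local Open Scope complex_scope.

(* R^n with its Borel (product) sigma-algebra *)
Notation Rspace R n := (n.-tuple (measurableTypeR R)).

(* Lebesgue measure on R^n, as an iterated product of the one-dimensional
   one; lebesgue_space_box identifies its values on boxes. *)
Section lebesgue_measure_space.
Variable R : realType.
Local Notation space n := (Rspace R n).

Definition cons_coord n (p : space n * measurableTypeR R) : space n.+1 :=
  [the space n.+1 of p.2 :: p.1].

Lemma measurable_cons_coord n : measurable_fun setT (@cons_coord n).
Proof. by apply: measurable_cons. Qed.

Section step.
Variables (n : nat) (m : {measure set (space n) -> \bar R}).

Definition lebesgue_step : set (space n.+1) -> \bar R :=
  pushforward (m \x @lebesgue_measure R)%E (@cons_coord n).

Let step0 : lebesgue_step set0 = 0%E.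
Proof. by rewrite /lebesgue_step /pushforward preimage_set0 measure0. Qed.

Let step_ge0 B : (0 <= lebesgue_step B)%E.
Proof. by apply: integral_ge0 => x _; exact: measure_ge0. Qed.

Let step_sigma_additive : semi_sigma_additive lebesgue_step.
Proof.
apply: measure_semi_sigma_additive; exact: measurable_cons_coord.
Qed.

HB.instance Definition _ := isMeasure.Build _ _ _ lebesgue_step
  step0 step_ge0 step_sigma_additive.
End step.

Fixpoint lebesgue_space n : {measure set (space n) -> \bar R} :=
  if n is m.+1 then lebesgue_step (lebesgue_space m)
  else \d_([tuple] : space 0).

Lemma lebesgue_space_box n (B : 'I_n -> set (measurableTypeR R)) :
  (forall i, measurable (B i)) ->
  lebesgue_space n [set x : space n | forall i, B i (tnth x i)] =
  (\prod_(i < n) lebesgue_measure (B i))%E.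
Proof.
elim: n B => [|n IH] B mB.
  by rewrite big_ord0 /= diracE mem_set // => -[].
rewrite big_ord_recl -(IH (fun i => B (lift ord0 i))) //.
rewrite muleC /= /lebesgue_step /pushforward.
set C := [set x : space n | _].
have mC : measurable C.
  rewrite (_ : C = \big[setI/setT]_(i < n)
      ((fun x : space n => tnth x i) @^-1` B (lift ord0 i))).
    apply: bigsetI_measurable => i _.
    rewrite -[X in measurable X]setTI.
    exact: (measurable_tnth i).
  rewrite -bigcap_seq; apply/seteqP; split=> x /= Cx i => [_|]; first exact: Cx.
  by apply: Cx; rewrite /= mem_index_enum.
rewrite -product_measure1E //; congr (_ _).
apply/seteqP; split=> -[t y] /=.
  move=> h; split; last exact: (h ord0).
  by move=> i; have := h (lift ord0 i); rewrite tnthS.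
move=> [ht hy] i; case: (unliftP ord0 i) => [j|] ->; last exact: hy.
by rewrite tnthS; exact: ht.
Qed.

End lebesgue_measure_space.

Definition cintegral (R : realType) (n : nat) (D : set (Rspace R n))
    (f : Rspace R n -> R[i]) : R[i] :=
  (\int[lebesgue_space R n]_(x in D) complex.Re (f x))
  +i* (\int[lebesgue_space R n]_(x in D) complex.Im (f x)).

Definition expi2pi (R : realType) (t : R) : R[i] :=
  cos (2 * pi * t) +i* sin (2 * pi * t).

Notation freq d := {ffun 'I_d -> int}.

Section fourier.
Variables (R : realType) (d : nat).
Implicit Types (k : freq d) (x : Rspace R d).

Definition cell : set (Rspace R d) :=
  [set x | forall i, - 2^-1 < tnth x i < 2^-1].

Definition translate x k : Rspace R d := [tuple tnth x i + (k i)%:~R | i < d].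

(* Representatives of the elements of L^oo_#(Y; R^(d x d)): since an element is
   a class modulo null sets, periodicity is only required almost everywhere. *)
Definition Linfty_per (A : Rspace R d -> 'M[R]_d) : Prop :=
  (forall a b, (fun x => A x a b) \in Lfun (lebesgue_space R d) +oo%E) /\
  (forall k, {ae lebesgue_space R d, forall x, A (translate x k) = A x}).

Definition phi k x : R[i] := expi2pi (\sum_i (k i)%:~R * tnth x i).

Definition fourier_coef (f : Rspace R d -> R) k : R[i] :=
  cintegral cell (fun x => (f x)%:C * phi (- k) x).

End fourier.

(* The index set Z^d_M; -M/2 <= k < M/2 is written without division. *)
Section grid.
Variables (d : nat) (M : 'I_d -> nat).

Definition in_grid (k : freq d) : bool :=
  [forall i, - (M i)%:Z <= 2 * k i < (M i)%:Z].

Record grid := Grid { grid_val :> freq d; gridP : in_grid grid_val }.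

HB.instance Definition _ := [isSub for grid_val].
HB.instance Definition _ := [Countable of grid by <:].

Let B := (2 * \sum_i M i).+1.
Let code (k : grid) : {ffun 'I_d -> 'I_B} :=
  [ffun i => inord (absz (k i + (M i)%:Z))].
Let decode (c : {ffun 'I_d -> 'I_B}) : option grid :=
  insub [ffun i => (c i : nat)%:Z - (M i)%:Z].

Let codeK : pcancel code decode.
Proof.
move=> k; rewrite /decode.
rewrite (_ : [ffun _ => _] = val k) ?valK //.
apply/ffunP => i; rewrite !ffunE.
have /forallP/(_ i) := gridP k; rewrite /= => /andP[h1 h2].
have hM : (M i <= \sum_j M j)%N by rewrite (bigD1 i) //= leq_addr.
by rewrite inordK; lia.
Qed.

HB.instance Definition _ := fintype.isFinite.Build grid (pcan_enumP codeK).

End grid.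

(* C^(d x N) has the joint index set {1..d} x Z^d_N; elements of
   [C^(d x N)]^2 are matrices over an enumeration of it, so that product, sum
   and adjoint are those of matrices. *)
Notation blockmx R M := 'M[R[i]]_#|{: 'I_ _ * grid M}|.

Section blocks.
Variables (R : realType) (d : nat) (M : 'I_d -> nat).

Definition of_blocks (U : grid M -> grid M -> 'M[R[i]]_d) : blockmx R M :=
  \matrix_(p, q) U (enum_val p).2 (enum_val q).2 (enum_val p).1 (enum_val q).1.

Definition block (U : blockmx R M) (k l : grid M) : 'M[R[i]]_d :=
  \matrix_(a, b) U (enum_rank (a, k)) (enum_rank (b, l)).

Definition omega (k n : freq d) : R[i] :=
  expi2pi (\sum_i (k i * n i)%:~R / (M i)%:R).

Definition DFT : blockmx R M :=
  ((\prod_i M i)%N%:R)^-1 *: of_blocks (fun m k => (omega (- (m : freq d)) k)%:M).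

(* The inverse DFT matrix, by its explicit formula. *)
Definition iDFT : blockmx R M := of_blocks (fun m k => (omega m k)%:M).

End blocks.

Section matrices.
Variables (R : realType) (d : nat) (A : Rspace R d -> 'M[R]_d) (N : 'I_d -> nat).

Definition double_size : 'I_d -> nat := fun i => (2 * N i)%N.
Definition double_size_pred : 'I_d -> nat := fun i => (2 * N i - 1)%N.

Definition Ahat_full : blockmx R N :=
  of_blocks (fun l k => \matrix_(a, b)
    cintegral (@cell R d)
      (fun x => (A x a b)%:C * phi k x * phi (- (l : freq d)) x)).

Definition A_full : blockmx R N := iDFT R N *m Ahat_full *m DFT R N.

Definition A_double : blockmx R double_size :=
  of_blocks (fun k l => (k == l)%:R *: \matrix_(a, b)
    \sum_(n : grid double_size_pred)
      omega R double_size k n * fourier_coef (fun x => A x a b) n).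

Definition shift_freq (s : {ffun 'I_d -> bool}) : freq d :=
  [ffun i => (s i : nat)%:Z].

Definition S_shift (s : {ffun 'I_d -> bool}) : blockmx R N :=
  of_blocks (fun m n =>
    ((m == n)%:R * omega R double_size (- shift_freq s) m)%:M).

(* Oddness of N makes 2r - s an index of Z^d_(2N). *)
Lemma double_sub_in_grid (hN : forall i, odd (N i)) (r : grid N)
    (s : {ffun 'I_d -> bool}) :
  in_grid double_size ((r : freq d) *+ 2 - shift_freq s).
Proof.
apply/forallP => i; rewrite /double_size.
have /forallP/(_ i) := gridP r; have := hN i.
rewrite mulr2n !ffunE /=; case: (s i) => /=; lia.
Qed.

Definition double_sub (hN : forall i, odd (N i)) (r : grid N)
    (s : {ffun 'I_d -> bool}) : grid double_size :=
  Grid (double_sub_in_grid hN r s).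

Definition A_shift (hN : forall i, odd (N i)) (s : {ffun 'I_d -> bool}) :
    blockmx R N :=
  of_blocks (fun k r => (k == r)%:R *:
    block A_double (double_sub hN r s) (double_sub hN r s)).

End matrices.

(* Main.v *)
(* The (l, k) block of the exact matrix is the Fourier coefficient of A at
   l - k.  On the right, the block at (l, k) collects, over all shifts s and
   grid points r, the phases e((2r - s).(n + k - l) / 2N) in front of the n-th
   Fourier coefficient.  As (r, s) varies, 2r - s runs through a complete residue
   system modulo 2N, so these phases sum to |2N| if n + k - l = 0 mod 2N and to 0
   otherwise.  Since N is odd, every component of n + k - l is smaller than 2N in
   absolute value, so no aliasing occurs and only n = l - k survives. *)

Require Import Defs.
From HB Require Import structures.
From mathcomp Require Import all_boot all_order all_algebra spectral.
From mathcomp Require Import complex ring lra zify.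
From mathcomp Require Import all_classical all_reals all_analysis.

Import Order.TTheory GRing.Theory Num.Theory.

Local Open Scope ring_scope.
Local Open Scope sesquilinear_scope.

(** * The character e(t) = exp(2 pi i t), written [expi2pi t] *)

Lemma expi2piD (R : realType) (s t : R) :
  expi2pi (s + t) = expi2pi s * expi2pi t.
Proof.
rewrite /expi2pi mulrDr cosD sinD; apply/eqP; rewrite eq_complex /=.
by apply/andP; split; apply/eqP; ring.
Qed.

Lemma expi2pi0 (R : realType) : expi2pi (0 : R) = 1.
Proof. by rewrite /expi2pi mulr0 cos0 sin0. Qed.

Lemma expi2pi_conj (R : realType) (t : R) : (expi2pi t)^* = expi2pi (- t).
Proof. by rewrite /expi2pi mulrN cosN sinN. Qed.

Lemma expi2pi_sum (R : realType) (I : finType) (F : I -> R) :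
  expi2pi (\sum_i F i) = \prod_i expi2pi (F i).
Proof. exact: (big_morph _ (@expi2piD R) (@expi2pi0 R)). Qed.

Lemma expi2piMn (R : realType) (t : R) n : expi2pi (t *+ n) = expi2pi t ^+ n.
Proof.
elim: n => [|n IH]; first by rewrite mulr0n expi2pi0.
by rewrite mulrS expi2piD IH exprS.
Qed.

Lemma expi2pi_int (R : realType) (m : int) : expi2pi (m%:~R : R) = 1.
Proof.
have nat n : expi2pi (n%:R : R) = 1.
  by rewrite expi2piMn /expi2pi mulr1 mulr_natl cos2pi sin_mulr2n sinpi mulr0
             mul0rn expr1n.
case: (intP m) => [|n|n]; rewrite ?expi2pi0 // ?nat //.
by rewrite mulrNz -expi2pi_conj nat rmorph1.
Qed.

(** The real part gives 1 - 2 sin^2(pi t) = 1, hence sin(pi t) = 0, while sin is positive on (0, pi)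
    and odd. *)
Lemma expi2pi_eq1 (R : realType) (t : R) :
  `|t| < 1 -> expi2pi t = 1 -> t = 0.
Proof.
move=> t1 [+ _]; rewrite -mulrA mulr_natl cos_mulr2n cos2sin2 => cos1.
have sin0 : sin (pi * t) = 0.
  by apply/eqP; rewrite -sqrf_eq0; apply/eqP; move: cos1; set y := _ ^+ 2; lra.
have pi0 := pi_gt0 R.
have pos (u : R) : 0 < u < 1 -> sin (pi * u) != 0.
  by move=> u01; rewrite gt_eqF // sin_gt0_pi //; nra.
move: t1; rewrite ltr_norml => /andP[t1 t2].
have [tn|tp|//] := ltgtP t 0.
  by have := pos (- t); rewrite mulrN sinN sin0 oppr0 eqxx => /(_ ltac:(lra)).
by have := pos t; rewrite sin0 eqxx => /(_ ltac:(lra)).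
Qed.

(** * Sums over grids and the one-dimensional phase sum *)

(** The grid is a product of intervals: -M/2 <= k < M/2 means k = c - floor(M/2) with 0 <= c < M,
    for either parity of M. The rest is distributivity. *)
Lemma sum_grid_prod (R : comPzSemiRingType) (d : nat) (M : 'I_d -> nat)
    (F : 'I_d -> int -> R) :
  \sum_(k : grid M) \prod_i F i (k i) =
  \prod_i \sum_(c < M i) F i ((c : nat)%:Z - (M i)./2%:Z).
Proof.
(* Distributivity wants one index type for all coordinates, so every range ['I_(M i)] is embedded in
   ['I_B]. *)
pose B := (\sum_i M i).+1.
have MB i : (M i <= B)%N by rewrite leqW // (bigD1 i) //= leq_addr.
under [RHS]eq_bigr => i _ do rewrite (big_ord_widen _
  (fun c => F i (c%:Z - (M i)./2%:Z)) (MB i)).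
rewrite bigA_distr_big_dep.
pose code (k : grid M) : {ffun 'I_d -> 'I_B} :=
  [ffun i => inord (absz (k i + (M i)./2%:Z))].
pose decode (c : {ffun 'I_d -> 'I_B}) : option (grid M) :=
  insub [ffun i => (c i : nat)%:Z - (M i)./2%:Z].
have codeE (k : grid M) i : (code k i : nat)%:Z = k i + (M i)./2%:Z
    /\ (code k i < M i)%N.
  have /forallP/(_ i) := gridP k => /andP[h1 h2].
  by have := MB i; rewrite /B => MBi; rewrite ffunE inordK; lia.
have codeK k : decode (code k) = Some k.
  rewrite /decode (_ : [ffun _ => _] = val k) ?valK //.
  by apply/ffunP => i; rewrite ffunE (codeE k i).1 addrK.
rewrite [RHS](reindex_omap code decode) => [|c /familyP cM].
  apply: eq_big => [k|k _].
    rewrite codeK eqxx andbT; symmetry; apply/familyP => i.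
    exact: (codeE k i).2.
  by apply: eq_bigr => i _; rewrite (codeE k i).1 addrK.
rewrite /decode insubT => [|/= h].
  apply/forallP => i; rewrite ffunE.
  by have := cM i; rewrite unfold_in; move: (nat_of_ord _) (M i); lia.
congr Some; apply/ffunP => i; apply/val_inj; have := cM i.
rewrite unfold_in => ci; apply/eqP; rewrite -eqz_nat (codeE _ i).1 /= ffunE.
by rewrite subrK.
Qed.

(* With z = e(m/2n), the left side is a power of z times the sum of z^j over
   0 <= j < 2n, which vanishes for z <> 1 as z^(2n) = 1. *)
Lemma sum_half_shifts (R : realType) (n : nat) (m : int) :
  (`|m| < 2 * n)%N ->
  (\sum_(b : bool) expi2pi ((- (b : nat)%:Z * m)%:~R / (2 * n)%:R : R)) *
  (\sum_(c < n) expi2pi ((((c : nat)%:Z - n./2%:Z) *+ 2 * m)%:~R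
                           / (2 * n)%:R : R)) =
  (2 * n)%:R * (m == 0)%:R.
Proof.
move=> mn; have n0 : (2 * n)%:R != 0 :> R by rewrite pnatr_eq0; lia.
have [->|m0] := eqVneq m 0.
  under eq_bigr => b _ do rewrite mulr0 mul0r expi2pi0.
  under [X in _ * X]eq_bigr => c _ do rewrite mulr0 mul0r expi2pi0.
  by rewrite !sumr_const card_bool card_ord mulr1 -natrM.
set z := expi2pi (m%:~R / (2 * n)%:R : R).
set y := expi2pi (- (m%:~R / (2 * n)%:R) : R).
have yz : y * z = 1 by rewrite -expi2piD addNr expi2pi0.
have z1 : z != 1.
  apply/eqP => /expi2pi_eq1; rewrite normrM normfV (ger0_norm (ler0n _ _)).
  rewrite ltr_pdivrMr ?mul1r ?lt0r ?n0 ?ler0n // -intr_norm -abszE.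
  rewrite -[_%:~R]/(_%:R) ltr_nat => /(_ mn)/eqP.
  by rewrite mulf_eq0 invr_eq0 (negPf n0) orbF intr_eq0 (negPf m0).
have zn : z ^+ (2 * n) = 1.
  by rewrite -expi2piMn -[X in expi2pi X]mulr_natr divfK // expi2pi_int.
rewrite big_bool /= mulN1r mulrNz mulNr oppr0 mul0r mul0r expi2pi0 -/y mulr0.
(* [w] is the phase of the centring offset [n./2]; without it the sum over [c] is geometric of ratio
   z^2. *)
set w := expi2pi (- (n./2%:R) * (m%:~R / (2 * n)%:R) *+ 2 : R).
under eq_bigr => c _.
  have -> : ((((c : nat)%:Z - n./2%:Z) *+ 2 * m)%:~R / (2 * n)%:R : R) =
      - (n./2%:R) * (m%:~R / (2 * n)%:R) *+ 2
        + m%:~R / (2 * n)%:R *+ 2 *+ c.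
    by rewrite intrM rmorphMn /= intrB -mulrA; move: (_ / _) => u; ring.
  rewrite expi2piD -/w 2!expi2piMn -/z.
  over.
(* As y z = 1, the nonzero factor (z - 1) z turns the shift sum y + 1 into z^2 - 1, and z^2 - 1
   times the geometric sum is z^(2n) - 1 = 0. *)
rewrite -mulr_sumr; apply: (@mulfI _ ((z - 1) * z)).
  rewrite mulf_neq0 ?subr_eq0 //; apply/eqP => z0.
  by move: yz; rewrite z0 mulr0 => /eqP; rewrite eq_sym oner_eq0.
have := subrX1 (z ^+ 2) n; rewrite -exprM zn subrr => /esym h.
transitivity (w * ((z ^+ 2 - 1) * \sum_(i < n) (z ^+ 2) ^+ i)).
  have -> : z ^+ 2 - 1 = (z - 1) * (y * z + z) by rewrite yz; ring.
  ring.
by rewrite h !mulr0.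
Qed.

(** * Multidimensional phases and their orthogonality *)

Lemma omegaDl (R : realType) d (M : 'I_d -> nat) (k l n : freq d) :
  omega R M (k + l) n = omega R M k n * omega R M l n.
Proof.
rewrite -expi2piD -big_split; congr expi2pi; apply: eq_bigr => i _ /=.
by rewrite ffunE mulrDl intrD mulrDl.
Qed.

Lemma omegaC (R : realType) d (M : 'I_d -> nat) (k n : freq d) :
  omega R M k n = omega R M n k.
Proof. by congr expi2pi; apply: eq_bigr => i _; rewrite [k i * _]mulrC. Qed.

Lemma omegaDr (R : realType) d (M : 'I_d -> nat) (k m n : freq d) :
  omega R M k (m + n) = omega R M k m * omega R M k n.
Proof. by rewrite !(omegaC _ _ _ k) omegaDl. Qed.

Lemma omegaN (R : realType) d (M : 'I_d -> nat) (k n : freq d) :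
  omega R M (- k) n = omega R M k (- n).
Proof.
congr expi2pi; apply: eq_bigr => i _.
by rewrite !ffunE mulrN mulNr.
Qed.

Lemma omega_conj (R : realType) d (M : 'I_d -> nat) (k n : freq d) :
  (omega R M k n)^* = omega R M (- k) n.
Proof.
rewrite expi2pi_conj -sumrN; congr expi2pi; apply: eq_bigr => i _.
by rewrite ffunE mulNr intrN mulNr.
Qed.

(** Brings the DFT phases to the modulus 2N of the shift phases. A component [N i = 0] is harmless,
    since division by 0 gives 0 on both sides. *)
Lemma omega_double (R : realType) d (N : 'I_d -> nat) (k n : freq d) :
  omega R (double_size N) (k *+ 2) n = omega R N k n.
Proof.
congr expi2pi; apply: eq_bigr => i _.
rewrite /double_size mulr2n ffunE -mulr2n -[_ *+ 2]mulr_natl natrM.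
by rewrite -mulrA intrM -mulf_div mulfV ?mul1r // pnatr_eq0.
Qed.

(** The phase is a product over coordinates, and the s_i and r_i vary independently, so the double
    sum is a product of the sums in [sum_half_shifts]. *)
Lemma sum_omega_double (R : realType) d (N : 'I_d -> nat) (m : freq d) :
  (forall i, `|m i| < 2 * N i)%N ->
  \sum_(s : {ffun 'I_d -> bool}) \sum_(r : grid N)
    omega R (double_size N) ((r : freq d) *+ 2 - shift_freq s) m =
  2 ^+ d * (\prod_i N i)%N%:R * (m == 0)%:R.
Proof.
move=> mN.
pose F i (k : int) : R[i] := expi2pi ((k * m i)%:~R / (2 * N i)%:R).
transitivity ((\sum_(s : {ffun 'I_d -> bool}) \prod_i F i (- (s i : nat)%:Z)) *
              (\sum_(r : grid N) \prod_i F i (r i *+ 2))).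
  rewrite big_distrlr; apply: eq_bigr => s _; apply: eq_bigr => r _ /=.
  rewrite /omega expi2pi_sum -big_split; apply: eq_bigr => i _ /=.
  rewrite -expi2piD; congr expi2pi.
  by rewrite /double_size mulr2n !ffunE addrC mulrDl intrD mulrDl mulr2n.
rewrite -(bigA_distr_bigA (fun i (b : bool) => F i (- (b : nat)%:Z))).
rewrite (@sum_grid_prod _ _ N (fun i k => F i (k *+ 2))) -big_split /=.
under eq_bigr => i _ do rewrite sum_half_shifts // natrM.
rewrite !big_split /= prodr_const card_ord natr_prod; congr (_ * _).
have [->|/eqP m0] := eqVneq m 0.
  by rewrite big1 // => i _; rewrite ffunE eqxx.
have [i /negPf mi] : exists i, m i != 0.
  apply: contrapT => /forallNP mi; apply: m0; apply/ffunP => i.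
  by rewrite ffunE; apply/eqP/negPn/negP; exact: mi.
by rewrite (bigD1 i) //= mi mul0r.
Qed.

Lemma phiD (R : realType) d (k l : freq d) (x : Rspace R d) :
  phi k x * phi l x = phi (k + l) x.
Proof.
rewrite /phi -expi2piD -big_split; congr expi2pi; apply: eq_bigr => i _ /=.
by rewrite ffunE intrD mulrDl.
Qed.

(** * Block calculus over the joint index *)

Lemma block_of_blocks (R : realType) d (M : 'I_d -> nat)
    (U : grid M -> grid M -> 'M[R[i]%C]_d) k l :
  block (of_blocks U) k l = U k l.
Proof. by apply/matrixP => a b; rewrite !mxE !enum_rankK. Qed.

Lemma blockP (R : realType) d (M : 'I_d -> nat) (U V : blockmx R M) :
  (forall k l, block U k l = block V k l) -> U = V.
Proof.
move=> UV; apply/matrixP => p q; rewrite -(enum_valK p) -(enum_valK q).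
case: (enum_val p) (enum_val q) => a k [b l].
by have /matrixP/(_ a b) := UV k l; rewrite !mxE.
Qed.

Lemma blockZ (R : realType) d (M : 'I_d -> nat) c (U : blockmx R M) k l :
  block (c *: U) k l = c *: block U k l.
Proof. by apply/matrixP => a b; rewrite !mxE. Qed.

Lemma block_sum (R : realType) d (M : 'I_d -> nat) (I : finType)
    (U : I -> blockmx R M) k l :
  block (\sum_i U i) k l = \sum_i block (U i) k l.
Proof.
apply/matrixP => a b; rewrite mxE !summxE.
by apply: eq_bigr => i _; rewrite mxE.
Qed.

Lemma block_mul (R : realType) d (M : 'I_d -> nat) (U V : blockmx R M) k l :
  block (U *m V) k l = \sum_j block U k j *m block V j l.
Proof.
apply/matrixP => a b; rewrite !mxE summxE.
under [RHS]eq_bigr => j _ do rewrite mxE.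
rewrite exchange_big pair_big /= (reindex (@enum_rank {: 'I_d * grid M})) /=.
  by apply: eq_bigr => -[c j] _; rewrite !mxE.
exact/onW_bij/enum_rank_bij.
Qed.

Lemma block_adjoint (R : realType) d (M : 'I_d -> nat) (U : blockmx R M) k l :
  block (U ^t*) k l = (block U l k) ^t*.
Proof. by apply/matrixP => a b; rewrite !mxE. Qed.

Lemma block_mul_diagl {R : realType} {d} {M : 'I_d -> nat} {U V : blockmx R M}
    {D : grid M -> 'M[R[i]%C]_d} {k l} :
  (forall m n, block U m n = (m == n)%:R *: D m) ->
  block (U *m V) k l = D k *m block V k l.
Proof.
move=> UD; rewrite block_mul (bigD1 k) //= UD eqxx scale1r big1 ?addr0 // => j.
by rewrite eq_sym UD => /negPf->; rewrite scale0r mul0mx.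
Qed.

Lemma block_mul_diagr {R : realType} {d} {M : 'I_d -> nat} {U V : blockmx R M}
    {D : grid M -> 'M[R[i]%C]_d} {k l} :
  (forall m n, block V m n = (m == n)%:R *: D m) ->
  block (U *m V) k l = block U k l *m D l.
Proof.
move=> VD; rewrite block_mul (bigD1 l) //= VD eqxx scale1r big1 ?addr0 // => j.
by rewrite VD => /negPf->; rewrite scale0r mulmx0.
Qed.

(** * Blocks of both sides, and the identities *)

Lemma block_Ahat_full (R : realType) d (A : Rspace R d -> 'M[R]_d)
    (N : 'I_d -> nat) l k a b :
  block (Ahat_full A N) l k a b =
  fourier_coef (fun x => A x a b) ((l : freq d) - (k : freq d)).
Proof.
rewrite block_of_blocks mxE /fourier_coef; congr cintegral.
apply/funext => x.
by rewrite -mulrA phiD opprB.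
Qed.

(** [S_shift] and [A_shift] are block diagonal, so one sum over r, between [DFT] and [iDFT],
    remains; unfolding [A_double] adds the sum over n. *)
Lemma block_shifted_summand (R : realType) d (A : Rspace R d -> 'M[R]_d)
    (N : 'I_d -> nat) (hN : forall i, odd (N i)) s l k a b :
  block ((S_shift R N s) ^t* *m DFT R N *m A_shift A hN s
         *m iDFT R N *m S_shift R N s) l k a b =
  ((\prod_i N i)%N%:R)^-1 *
  \sum_(n : grid (double_size_pred N)) fourier_coef (fun x => A x a b) n *
    \sum_(r : grid N) omega R (double_size N)
      ((r : freq d) *+ 2 - shift_freq s)
      ((n : freq d) + (k : freq d) - (l : freq d)).
Proof.
pose c (m : grid N) := omega R (double_size N) (- shift_freq s) m.
have SE m n : block (S_shift R N s) m n = (m == n)%:R *: (c m)%:M.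
  by rewrite block_of_blocks scale_scalar_mx.
have SaE m n : block ((S_shift R N s) ^t*) m n = (m == n)%:R *: ((c m)^* )%:M.
  rewrite block_adjoint SE linearZ /= tr_scalar_mx map_mxZ map_scalar_mx.
  by rewrite /= conjC_nat eq_sym; have [->|] := eqVneq; rewrite ?scale0r.
have AE m n : block (A_shift A hN s) m n = (m == n)%:R *:
    block (A_double A N) (double_sub hN m s) (double_sub hN m s).
  by rewrite block_of_blocks; have [->|] := eqVneq; rewrite ?scale0r.
rewrite (block_mul_diagr SE) block_mul.
under [in LHS]eq_bigr => r _.
  rewrite (block_mul_diagr AE) (block_mul_diagl SaE).
  rewrite /DFT blockZ !block_of_blocks eqxx scale1r -scalemxAr.
  rewrite -scalar_mxM -scalemxAl mul_scalar_mx mul_mx_scalar.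
  over.
rewrite mul_mx_scalar mxE summxE !mulr_sumr.
under [RHS]eq_bigr => n _ do rewrite !mulr_sumr.
rewrite [RHS]exchange_big; apply: eq_bigr => r _ /=.
rewrite !mxE !mulr_sumr; apply: eq_bigr => n _.
(* Modulo 2N, -s is paired with -l by the adjoint, with n by [A_double] and with k by [S_shift]; 2r
   is paired with -l by [DFT], with n by [A_double] and with k by [iDFT]. *)
rewrite omega_conj (omegaN _ _ _ (- shift_freq s)) (omegaC _ _ N (- _)).
by rewrite -!(omega_double _ _ N) /c !omegaDr !omegaDl; ring.
Qed.

Theorem lemma19 (R : realType) (d : nat) (hd : d = 2%N \/ d = 3%N)
    (A : Rspace R d -> 'M[R]_d) (hA : Linfty_per A)
    (N : 'I_d -> nat) (hN : forall i, odd (N i)) :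
  A_full A N =
    (2 ^- d : R[i]) *: \sum_(s : {ffun 'I_d -> bool})
      (iDFT R N *m (S_shift R N s) ^t* *m DFT R N *m A_shift A hN s
       *m iDFT R N *m S_shift R N s *m DFT R N)
  /\
  Ahat_full A N =
    (2 ^- d : R[i]) *: \sum_(s : {ffun 'I_d -> bool})
      ((S_shift R N s) ^t* *m DFT R N *m A_shift A hN s
       *m iDFT R N *m S_shift R N s).
Proof.
have Ahat : Ahat_full A N = (2 ^- d : R[i]) *: \sum_(s : {ffun 'I_d -> bool})
    ((S_shift R N s) ^t* *m DFT R N *m A_shift A hN s
     *m iDFT R N *m S_shift R N s).
  apply: blockP => l k; apply/matrixP => a b.
  rewrite block_Ahat_full blockZ block_sum mxE summxE.
  under eq_bigr => s _ do rewrite block_shifted_summand.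
  rewrite -mulr_sumr exchange_big /=.
  under [X in _ * (_ * X)]eq_bigr => n _ do rewrite -mulr_sumr.
  (* For odd N the components of l and k are at most (N - 1)/2 in absolute value, so those of l - k
     are at most N - 1, the exact bound of the grid of size 2N - 1. *)
  have lk_grid : in_grid (double_size_pred N) ((l : freq d) - (k : freq d)).
    apply/forallP => i; rewrite !ffunE /double_size_pred.
    have /forallP/(_ i) := gridP l; have /forallP/(_ i) := gridP k.
    by have := hN i; move: (N i) ((l : freq d) i)
      ((k : freq d) i) => p x y; lia.
  (* Both n and k - l are bounded by N - 1, so their sum is bounded by 2N - 2. *)
  have bound (n : grid (double_size_pred N)) i :
      (`|((n : freq d) + (k : freq d) - (l : freq d))%R i| < 2 * N i)%N.
    have /forallP/(_ i) := gridP l; have /forallP/(_ i) := gridP k.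
    have /forallP/(_ i) := gridP n; rewrite !ffunE /double_size_pred.
    by have := hN i; move: (N i) ((n : freq d) i)
      ((l : freq d) i) ((k : freq d) i) => p z x y; lia.
  rewrite (bigD1 (Grid lk_grid)) //=.
  rewrite [X in _ * (_ * (_ + X))]big1 ?addr0 => [|n n_lk].
    rewrite sum_omega_double => [|i]; last exact: (bound (Grid lk_grid)).
    (* The orthogonality constant 2^d |N| cancels the averaging factor 2^-d and the 1/|N| of [DFT];
       oddness makes |N| nonzero. *)
    rewrite subrK subrr eqxx mulr1 mulrA -invfM mulrC mulfK //.
    rewrite mulf_neq0 ?expf_neq0 ?pnatr_eq0 // -lt0n prodn_gt0 // => i.
    by rewrite odd_gt0.
  rewrite sum_omega_double // subr_eq0 eq_sym -subr_eq eq_sym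
    [_ == _](negPf n_lk).
  by rewrite !mulr0.
(* The identity for [A_full] is the one for [Ahat_full] multiplied by [iDFT] on the left and [DFT]
   on the right. *)
split=> //; rewrite /A_full Ahat -(scalemxAr _ (iDFT R N)).
rewrite -scalemxAl mulmx_sumr mulmx_suml.
by congr (_ *: _); apply: eq_bigr => s _; rewrite !mulmxA.
Qed.
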